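(* For every integer $k\ge 1$ and every $n\ge 4k$ divisible by $2k$, Alice has a winning strategy in the prefix normal game with blocks of length $2k$ on $n$ positions.
   Context: A binary word $w$ is prefix normal if for every $1\le i\le |w|$, no (contiguous) substring of $w$ of length $i$ contains more $1$s than the prefix of $w$ of length $i$. Prefix normal game with blocks: integers $n$ and $k\ge 1$ are given with $2k$ dividing $n$ (and $n\ge 4k$). There are positions $1,\dots,n$. The first $4k$ positions are set to $1$ before the game starts. The remaining $n-4k$ empty positions are divided into consecutive blocks of length $2k$. Each round proceeds as follows: Bob picks a block that is still empty, chooses any $k$ of its $2k$ positions and sets them to arbitrary values in $\{0,1\}$; then Alice sets the remaining $k$ positions of the same block to values of her choice. Rounds are repeated until every position is filled. Alice wins if and only if the resulting binary word of length $n$ is prefix normal. *)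

(* Defs.v *)
From mathcomp Require Import all_boot.

Set Implicit Arguments.
Unset Strict Implicit.
Unset Printing Implicit Defensive.

Definition prefix_normal (w : seq bool) : Prop :=
  forall (i : nat) (s : seq bool),
    1 <= i <= size w -> infix s w -> size s = i ->
    count_mem true s <= count_mem true (take i w).

(* Positions 1, ..., n are represented by 'I_n, that is, shifted to start     *)
(* from 0; None marks an empty position.                                      *)
Definition board (n : nat) := {ffun 'I_n -> option bool}.

Definition start (k n : nat) : board n :=
  [ffun i : 'I_n => if i < 4 * k then Some true else None].

Definition block_index (k n : nat) := 'I_((n - 4 * k) %/ (2 * k)).

Definition block (k n : nat) (j : block_index k n) : {set 'I_n} :=
  [set i : 'I_n | 4 * k + j * (2 * k) <= i < 4 * k + j.+1 * (2 * k)].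

(* A move of Bob is a block together with a partial assignment, whose support *)
(* None.-support m.2 is the set of positions that Bob fills.                  *)
Definition bob_move (k n : nat) := (block_index k n * board n)%type.

Definition legal (k n : nat) (p : board n) (m : bob_move k n) : bool :=
  [&& [forall i in block m.1, p i == None],
      None.-support m.2 \subset block m.1
    & #|None.-support m.2| == k].

Definition after_bob (k n : nat) (p : board n) (m : bob_move k n) : board n :=
  [ffun i => if m.2 i is Some b then Some b else p i].

(* Only the values of a at the positions of block j that are still empty      *)
(* matter, so every a is an admissible reply of Alice.                        *)
Definition after_alice (k n : nat) (p : board n) (j : block_index k n)
    (a : {ffun 'I_n -> bool}) : board n :=
  [ffun i => if (i \in block j) && (p i == None) then Some (a i) else p i].

(* A history lists the moves of Bob, most recent first. Alice's strategy sees *)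
(* the whole history, including the move she replies to; her own earlier      *)
(* replies are determined by the strategy and the tail of the history.        *)
Definition strategy (k n : nat) := seq (bob_move k n) -> {ffun 'I_n -> bool}.

Fixpoint board_after (k n : nat) (sigma : strategy k n)
    (h : seq (bob_move k n)) : board n :=
  if h is m :: h' then
    after_alice (after_bob (board_after sigma h') m) m.1 (sigma h)
  else start k n.

Fixpoint legal_play (k n : nat) (sigma : strategy k n)
    (h : seq (bob_move k n)) : bool :=
  if h is m :: h' then
    legal_play sigma h' && legal (board_after sigma h') m
  else true.

(* The play h is over exactly when its board is a total word w.               *)
Definition winning (k n : nat) (sigma : strategy k n) : Prop :=
  forall (h : seq (bob_move k n)) (w : n.-tuple bool),
    legal_play sigma h ->
    board_after sigma h = [ffun i => Some (tnth w i)] ->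
    prefix_normal w.

(* Main.v *)
(* Alice completes every block so that it contains exactly k ones. Every      *)
(* prefix of length x >= 4k then has between (x + 3k) / 2 and (x + 5k) / 2    *)
(* ones, so a factor of length l that starts after the initial ones has at    *)
(* most l / 2 + k ones, while the prefix of length l has l (if l <= 4k) or at *)
(* least l / 2 + 3k / 2 of them. A factor that starts at position a <= 4k     *)
(* loses a ones from the prefix of the same length and gains at most a.       *)
Require Import Defs.
From mathcomp Require Import all_boot.
From mathcomp Require Import zify.

Set Implicit Arguments.
Unset Strict Implicit.
Unset Printing Implicit Defensive.

(** Bob fills only half of an empty block, so he places at most k ones and leaves k holes, and Alice
    can always top the block up to exactly k ones ([legal_after_bob], [card_ones_fill]). Hence
    [balanced] is preserved throughout the play ([balanced_filled_board]). In a balanced word the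
    number of ones grows at density 1/2 after the initial run, with an error bounded in terms of k
    only ([count_take_bounds]). The 4k initial ones give prefixes a head start that exceeds this
    error ([balanced_prefix_normal]). *)

Lemma count_take_add (s : seq bool) (x y : nat) :
  count_mem true (take (x + y) s) =
  count_mem true (take x s) + count_mem true (take y (drop x s)).
Proof. by rewrite takeD count_cat. Qed.

Lemma count_take_le (s : seq bool) (x : nat) : count_mem true (take x s) <= x.
Proof.
by apply: leq_trans (count_size _ _) _; rewrite size_take_min geq_minl.
Qed.

Lemma count_infix (s w : seq bool) : infix s w ->
  exists2 a, a + size s <= size w &
    count_mem true (take (a + size s) w) =
    count_mem true (take a w) + count_mem true s.
Proof.
move=> /infixP[s1 [s2 ->]]; exists (size s1).
  by rewrite !size_cat leq_add2l leq_addr.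
by rewrite count_take_add drop_size_cat // (take_size_cat _ (erefl (size s))).
Qed.

Section BalancedWord.

Variables (k M : nat) (w : seq bool).
Hypotheses (k_gt0 : 0 < k) (size_w : size w = 4 * k + M * (2 * k)).
Hypothesis w_init : count_mem true (take (4 * k) w) = 4 * k.
Hypothesis w_block : forall q, q < M ->
  count_mem true (take (2 * k) (drop (4 * k + q * (2 * k)) w)) = k.

Lemma count_take_init x : x <= 4 * k -> count_mem true (take x w) = x.
Proof.
move=> le_x; have := w_init; rewrite -{1}(subnKC le_x) count_take_add.
have := count_take_le w x.
have := count_take_le (drop x w) (4 * k - x).
lia.
Qed.

Lemma count_take_boundary q : q <= M ->
  count_mem true (take (4 * k + q * (2 * k)) w) = 4 * k + q * k.
Proof.
elim: q => [_|q IHq lt_qM]; first by rewrite !mul0n !addn0.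
rewrite (mulSnr q) addnA count_take_add IHq ?(ltnW lt_qM) // w_block //; lia.
Qed.

(** At a block boundary, twice the count exceeds the length by exactly 4k. The next r positions of a
    block hold t ones with t at most r and k, and t at least r - k because the other 2k - r
    positions must hold the remaining k - t. So 2t - r lies between -k and k. *)
Lemma count_take_bounds x : 4 * k <= x <= size w ->
  x + 3 * k <= 2 * count_mem true (take x w) <= x + 5 * k.
Proof.
move=> /andP[le_4k]; rewrite size_w => le_x.
have k2_gt0 : 0 < 2 * k by rewrite muln_gt0.
pose q := (x - 4 * k) %/ (2 * k); pose r := (x - 4 * k) %% (2 * k).
have def_x : x = 4 * k + q * (2 * k) + r.
  by rewrite -addnA -divn_eq subnKC.
have lt_r : r < 2 * k by rewrite ltn_mod.
clearbody q r.
have le_qM : q <= M.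
  by rewrite -(leq_pmul2r k2_gt0); move: le_x; rewrite def_x; lia.
have fq := count_take_boundary le_qM.
have fx : count_mem true (take x w) = 4 * k + q * k +
    count_mem true (take r (drop (4 * k + q * (2 * k)) w)).
  by rewrite def_x count_take_add fq.
have le_r := count_take_le (drop (4 * k + q * (2 * k)) w) r.
(* The case r = 0 is separate because q may then equal M, and there is no block M. *)
rewrite fx; have [r0 | r_gt0] := posnP r; first lia.
have lt_qM : q < M.
  by rewrite -(ltn_pmul2r k2_gt0); move: le_x; rewrite def_x; lia.
have := w_block lt_qM; rewrite -{1}(subnKC (ltnW lt_r)) count_take_add.
have := count_take_le
  (drop r (drop (4 * k + q * (2 * k)) w)) (2 * k - r).
lia.
Qed.

Lemma balanced_prefix_normal : prefix_normal w.
Proof.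
move=> l s /andP[l_gt0 le_l] /count_infix[a le_end count_s] sz_s.
rewrite sz_s in le_end count_s.
have le_s : count_mem true s <= l by rewrite -sz_s count_size.
have [le_l4 | lt_l4] := leqP l (4 * k); first by rewrite count_take_init.
have [le_a | lt_a] := leqP a (4 * k).
  (* Split the prefix of length a + l at l instead of at a: its last a positions hold at most a
     ones, as many as its first a. *)
  move: count_s; rewrite (count_take_init le_a) addnC count_take_add.
  have := count_take_le (drop l w) a; lia.
have /andP[lb_l _] : l + 3 * k <= 2 * count_mem true (take l w) <= l + 5 * k.
  by rewrite count_take_bounds // (ltnW lt_l4).
have /andP[lb_a _] :
    a + 3 * k <= 2 * count_mem true (take a w) <= a + 5 * k.
  by rewrite count_take_bounds // (ltnW lt_a) (leq_trans (leq_addr l _)).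
have := @count_take_bounds (a + l).
rewrite le_end (leq_trans (ltnW lt_a) (leq_addr l _)) => /(_ isT)/andP[_].
rewrite count_s; lia.
Qed.

End BalancedWord.

(** Passes from counts in a word, used for prefix normality, to cardinals of sets of positions, used
    for the game. *)
Lemma count_slice n (w : n.-tuple bool) a d : a + d <= n ->
  count_mem true (take d (drop a w)) =
  #|[set i : 'I_n | a <= i < a + d & tnth w i]|.
Proof.
move=> le_n; have sz : size (take d (drop a w)) = d.
  rewrite size_takel // size_drop size_tuple leq_subRL //.
  by rewrite (leq_trans _ le_n) ?leq_addr.
rewrite -sum1_count (big_nth false) sz big_mkcond /=.
transitivity (\sum_(a <= i < a + d) (nth false w i : nat)).
  (* The explicit 0 lets [big_addn] shift the range down by a. *)
  rewrite -[RHS]/(\sum_(0 + a <= i < a + d) (nth false w i : nat)).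
  rewrite big_addn addKn [LHS]big_nat_cond [RHS]big_nat_cond.
  apply: eq_bigr => i /andP[/andP[_ lt_i] _].
  by rewrite nth_take // nth_drop addnC; case: nth.
rewrite big_geq_mkord -sum1dep_card.
rewrite (big_ord_widen_cond _ (leq a) (fun i => nth false w i : nat) le_n) /=.
rewrite [LHS]big_mkcond [RHS]big_mkcond; apply: eq_bigr => i _ /=.
rewrite (tnth_nth false) andbC.
by case: nth; case: ifP; rewrite ?andbT ?andbF //= => ->.
Qed.

Lemma card_interval n a d : a + d <= n ->
  #|[set i : 'I_n | a <= i < a + d]| = d.
Proof.
move=> le_n; rewrite -sum1dep_card.
transitivity (\sum_(a <= i < a + d) 1).
  rewrite big_geq_mkord (big_ord_widen_cond _ (leq a) (fun=> 1) le_n) /=.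
  by apply: eq_bigl => i; rewrite andbC.
by rewrite sum_nat_const_nat addKn muln1.
Qed.

Section Strategy.

Variables k n : nat.
Hypotheses (hn : 4 * k <= n) (hdiv : 2 * k %| n).

Local Notation idx := (block_index k n).
Local Notation brd := (board n).

Definition ones (p : brd) (j : idx) : {set 'I_n} :=
  [set i in block j | p i == Some true].

Definition holes (p : brd) (j : idx) : {set 'I_n} :=
  [set i in block j | p i == None].

Lemma in_ones p j i : (i \in ones p j) = (i \in block j) && (p i == Some true).
Proof. exact: in_set. Qed.

Lemma in_holes p j i : (i \in holes p j) = (i \in block j) && (p i == None).
Proof. exact: in_set. Qed.

(** Which holes receive the missing ones is immaterial; the enumeration only makes the choice
    explicit. *)
Definition fill (p : brd) (j : idx) : {ffun 'I_n -> bool} :=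
  [ffun i => i \in take (k - #|ones p j|) (enum (holes p j))].

(** Alice's reply depends on a board shaped by her own earlier replies. Building that board first,
    with the replies inlined, avoids a circular definition of the strategy. *)
Fixpoint filled_board (h : seq (bob_move k n)) : brd :=
  if h is m :: h' then
    let p := after_bob (filled_board h') m in after_alice p m.1 (fill p m.1)
  else start k n.

Definition fill_strategy : strategy k n := fun h =>
  if h is m :: h' then fill (after_bob (filled_board h') m) m.1
  else [ffun => false].

Lemma board_after_fill h : board_after fill_strategy h = filled_board h.
Proof. by elim: h => //= m h ->. Qed.

Lemma blocks_length : n = 4 * k + (n - 4 * k) %/ (2 * k) * (2 * k).
Proof.
rewrite divnK ?subnKC // dvdn_subr //; apply/dvdnP; exists 2; lia.
Qed.

Lemma block_inj (i : 'I_n) (j j' : idx) :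
  i \in block j -> i \in block j' -> j = j'.
Proof.
rewrite !inE => ij ij'; apply/val_inj => /=.
have [lt_jj|lt_jj|//] := ltngtP j j'; nia.
Qed.

Lemma card_block (j : idx) : #|block j| = 2 * k.
Proof.
rewrite -[RHS](@card_interval n (4 * k + j * (2 * k))).
  by apply/eq_card=> i; rewrite !in_set (mulSnr j) addnA.
rewrite -addnA -(mulSnr _ (2 * k)) [leqRHS]blocks_length leq_add2l leq_mul2r.
by rewrite ltn_ord orbT.
Qed.

Lemma card_ones_fill (p : brd) (j : idx) :
  #|ones p j| <= k <= #|ones p j| + #|holes p j| ->
  #|ones (after_alice p j (fill p j)) j| = k.
Proof.
move=> /andP[le_ones le_k].
pose A := [set i in take (k - #|ones p j|) (enum (holes p j))].
have -> : ones (after_alice p j (fill p j)) j = ones p j :|: A.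
  apply/setP=> i; rewrite in_setU [i \in A]in_set !in_ones !ffunE.
  have [ij|nij] := boolP (i \in block j) => /=; last first.
    apply/esym/negbTE; apply: contra nij => /mem_take.
    by rewrite mem_enum in_holes => /andP[].
  have notA : p i != None -> i \notin take (k - #|ones p j|) (enum (holes p j)).
    by apply: contra => /mem_take; rewrite mem_enum in_holes => /andP[].
  by case E: (p i) notA => [[]|] //= /(_ isT)/negbTE->.
have card_A : #|A| = k - #|ones p j|.
  rewrite cardsE (card_uniqP _) ?take_uniq ?enum_uniq // size_takel //.
  by rewrite -cardE; lia.
rewrite cardsU (_ : _ :&: _ = set0) ?cards0 ?card_A; first lia.
apply/setP=> i; rewrite in_setI in_ones [i \in A]in_set in_set0.
apply/negbTE/negP=> /andP[/andP[_ /eqP pi]] /mem_take.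
by rewrite mem_enum in_holes pi andbF.
Qed.

(** Since the block was empty, its ones lie among the k positions Bob has just filled, and its holes
    are the other k. This supplies the hypothesis of [card_ones_fill]. *)
Lemma legal_after_bob (p : brd) (m : bob_move k n) : legal p m ->
  #|ones (after_bob p m) m.1| <= k /\ #|holes (after_bob p m) m.1| = k.
Proof.
case: m => j b /= /and3P[/= /forall_inP pN sub /eqP card_b].
split.
  rewrite -[leqRHS]card_b; apply/subset_leq_card/subsetP=> i.
  rewrite in_ones ffunE [i \in None.-support b]inE => /andP[/pN/eqP->].
  by case: (b i).
have -> : holes (after_bob p (j, b)) j = block j :\: [set i in None.-support b].
  apply/setP=> i; rewrite in_setD in_holes ffunE andbC.
  rewrite [i \in [set _ in None.-support b]]in_set [i \in None.-support b]inE.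
  have [/pN/eqP ->|_] := boolP (i \in block j); last by rewrite !andbF.
  by case: (b i).
have /setIidPr E : [set i in None.-support b] \subset block j.
  by apply/subsetP=> i; rewrite in_set => /(subsetP sub).
have card_S : #|[set i in None.-support b]| = k.
  by rewrite -[RHS]card_b; apply/eq_card=> i; rewrite in_set.
by rewrite cardsD E card_S card_block; lia.
Qed.

(** Invariant after each reply of Alice; the first alternative describes a block not yet chosen. *)
Definition balanced (p : brd) : Prop :=
  (forall i : 'I_n, i < 4 * k -> p i = Some true) /\
  (forall j : idx, {in block j, forall i, p i = None} \/ #|ones p j| = k).

Lemma balanced_filled_board h :
  legal_play fill_strategy h -> balanced (filled_board h).
Proof.
elim: h => [_|m h IHh] /=.
  split=> [i|j]; first by rewrite ffunE => ->.
  left=> i; rewrite inE => /andP[le_i _].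
  by rewrite ffunE ltnNge (leq_trans _ le_i) ?leq_addr.
rewrite board_after_fill => /andP[/IHh[init blk] leg].
have [le_o eq_h] := legal_after_bob leg.
(* A round changes nothing outside its block. *)
have out (i : 'I_n) : i \notin block m.1 ->
    after_alice (after_bob (filled_board h) m) m.1
      (fill (after_bob (filled_board h) m) m.1) i = filled_board h i.
  move=> nij; rewrite ffunE (negbTE nij) ffunE.
  case/and3P: leg => _ /subsetP/(_ i) sub _.
  by case E: (m.2 i) => [b|//]; case/negP: nij; apply: sub; rewrite inE E.
split=> [i lt_i|j]; first by rewrite out ?init // inE; lia.
have [-> | ne_j] := eqVneq j m.1.
  by right; apply: card_ones_fill; lia.
have nin (i : 'I_n) : i \in block j -> i \notin block m.1.
  by move=> ij; apply: contra ne_j => /(block_inj ij) ->.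
have [N|O] := blk j; [left=> i ij|right].
  by rewrite out ?nin ?N.
rewrite -[RHS]O; apply/eq_card => i; rewrite !in_ones.
by apply: andb_id2l => ij; rewrite out ?nin.
Qed.

End Strategy.

Theorem lemma10 (k n : nat) (hk : 1 <= k) (hn : 4 * k <= n)
    (hdiv : 2 * k %| n) :
  exists sigma : strategy k n, winning sigma.
Proof.
exists (@fill_strategy k n) => h w leg full.
have := balanced_filled_board hn hdiv leg.
rewrite -board_after_fill full => -[init blk].
have len := blocks_length hn hdiv.
have k2_gt0 : 0 < 2 * k by rewrite muln_gt0.
apply: (@balanced_prefix_normal k ((n - 4 * k) %/ (2 * k))) => //.
- by rewrite size_tuple.
- rewrite -[X in take _ X]drop0 count_slice //.
  rewrite -[RHS](@card_interval n 0) //.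
  apply/eq_card=> i; rewrite !in_set; apply: andb_idr => /init.
  by rewrite ffunE => -[->].
- move=> q lt_q; pose j : block_index k n := Ordinal lt_q.
  have end_j : 4 * k + q * (2 * k) + 2 * k <= n.
    by rewrite -addnA -(mulSnr _ (2 * k)) [leqRHS]len leq_add2l leq_pmul2r.
  rewrite count_slice //.
  (* A total board has no empty block: the first position of block q already carries a value. *)
  have [N|card_j] := blk j.
    have lt_n : 4 * k + q * (2 * k) < n by lia.
    have /N : Ordinal lt_n \in block j by rewrite inE /=; lia.
    by rewrite ffunE.
  rewrite -[RHS]card_j; apply/eq_card=> i.
  rewrite in_ones !in_set ffunE (mulSnr q) addnA.
  by case: (tnth w i).
Qed.
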